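(* Let $n=2^s$, $q=2^r$ ($s,r$ positive integers), $N=|SL(n,q)|$, and let $\{C_i\}_{i=0}^N$ be the weight distribution of the code $C(SL(n,q))$. Then for $0\le i\le N$, \[ C_i=\sum\prod_{\beta\in\mathbb{F}_q}\binom{n_\beta}{\nu_\beta}, \] where the sum runs over all families of nonnegative integers $\{\nu_\beta\}_{\beta\in\mathbb{F}_q}$ with $\sum_\beta\nu_\beta=i$ and $\sum_\beta\nu_\beta\beta=0$ (an identity in $\mathbb{F}_q$), and $n_\beta=|\{g\in SL(n,q):Tr(g)=\beta\}|=q^{\binom{n}{2}-1}\{\prod_{j=2}^n(q^j-1)+1+q\theta(\beta)\}$ with $\theta(\beta)=K_{n-2}(\lambda;\beta^{-1})$ for $\beta\ne0$ and $\theta(0)=0$.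
   Context: $\mathbb{F}_q$ is the field with $q$ elements, $tr$ the absolute trace to $\mathbb{F}_2$, $\lambda(x)=(-1)^{tr(x)}$; $K_m(\lambda;a)=\sum_{\alpha_1,\dots,\alpha_m\in\mathbb{F}_q^*}\lambda(\alpha_1+\cdots+\alpha_m+a\alpha_1^{-1}\cdots\alpha_m^{-1})$ for $m\ge1$, and $K_0(\lambda;a)=\lambda(a)$. $Tr$ is the matrix trace; for a fixed ordering $g_1,\dots,g_N$ of $SL(n,q)$ and $v=(Tr(g_1),\dots,Tr(g_N))\in\mathbb{F}_q^N$, $C(SL(n,q))=\{u\in\mathbb{F}_2^N:u\cdot v=0\}$ (dot product in $\mathbb{F}_q$). $C_i$ is the number of codewords of Hamming weight $i$. Convention: $\binom{b}{a}=0$ if $b<a$. *)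

(* Defs.v *)
From mathcomp Require Import all_boot all_order all_algebra.
Set Implicit Arguments. Unset Strict Implicit. Unset Printing Implicit Defensive.
Import GRing.Theory.
Local Open Scope ring_scope.

(* absolute trace F_q -> F_2 (valued in F), for q = 2^r *)
Definition abs_tr (F : finFieldType) (r : nat) (x : F) : F :=
  \sum_(k < r) x ^+ (2 ^ k).

Definition lam (F : finFieldType) (r : nat) (x : F) : int :=
  if abs_tr r x == 0 then 1 else -1.

Definition Kloos (F : finFieldType) (r m : nat) (a : F) : int :=
  if m is 0 then lam r a
  else \sum_(al : {ffun 'I_m -> F} | [forall j, al j != 0])
         lam r (\sum_j al j + a * (\prod_j al j)^-1).

Definition theta (F : finFieldType) (r n : nat) (b : F) : int :=
  if b == 0 then 0 else Kloos r (n - 2) b^-1.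

Definition SLset (F : finFieldType) (n : nat) : {set 'M[F]_n} :=
  [set g : 'M[F]_n | \det g == 1].

Definition nbeta (F : finFieldType) (n : nat) (b : F) : nat :=
  #|[set g in SLset F n | \tr g == b]|.

(* C_i for the code C(SL(n,q)) w.r.t. the ordering g : 'I_N -> SL(n,q):
   number of u in F_2^N with u . v = 0 in F_q and Hamming weight i *)
Definition weight_count (F : finFieldType) (n N : nat)
    (g : 'I_N -> 'M[F]_n) (i : nat) : nat :=
  #|[set u : {ffun 'I_N -> bool} |
      (\sum_(j < N) (u j)%:R * \tr (g j) == 0) && (#|[pred j | u j]| == i)%N]|.

(* Main.v *)
Require Import Defs.
From mathcomp Require Import all_boot all_order all_fingroup all_algebra all_field ring.
Set Implicit Arguments. Unset Strict Implicit. Unset Printing Implicit Defensive.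
Import GRing.Theory.
Local Open Scope ring_scope.

(** Let [psi] be a nontrivial additive character and let [x] be the corner entry
    of [g]. If [x <> 0], Schur's formula expresses [\det g] and [\tr g] through
    the complement of [x], and summing over the border of [g] leaves the same sum
    for size [n - 1]; if [x = 0], adding multiples of the first row to the others
    keeps [\det g] but moves [\tr g], so these [g] contribute [0]. Hence the sum
    of [psi (\tr g)] over [\det g = c] is [q ^ 'C(n, 2)] times a Kloosterman sum
    at [c]. Fourier inversion in [a] of the sums of [psi (a * \tr g)] over [SL_n]
    then gives [nbeta]; since [n] is a power of [2], the Kloosterman sum at [a ^ n]
    is the one at [a], by Frobenius. The weight distribution is obtained by sorting
    the supports of codewords by their intersections with the trace fibres. *)

(** * Orthogonality for a nontrivial additive character *)

Section AdditiveCharacter.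

Variables (F : finFieldType) (R : idomainType) (psi : F -> R).
Hypothesis psi0 : psi 0 = 1.
Hypothesis psiD : {morph psi : x y / x + y >-> x * y}.
Hypothesis psi_nontrivial : exists z, psi z != 1.

(** Reindexing by [h] multiplies the sum by [c <> 1], and [R] is a domain. Every vanishing of a
    character sum below comes from a suitable shift [h]. *)
Lemma sum_char_eq0 (I : finType) (f : I -> R) (h : I -> I) (c : R) :
  bijective h -> c != 1 -> (forall i, f (h i) = c * f i) -> \sum_i f i = 0.
Proof.
move=> h_bij c1 fh; apply/eqP; have: (c - 1) * \sum_i f i == 0.
  rewrite mulrBl mul1r subr_eq0 mulr_sumr [X in _ == X](reindex h) /=.
    by apply/eqP/eq_bigr => i _; rewrite fh.
  exact: onW_bij.
by rewrite mulf_eq0 subr_eq0 (negPf c1).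
Qed.

Lemma sum_char (a : F) : \sum_x psi (x * a) = if a == 0 then #|F|%:R else 0.
Proof.
have [->|a0] := eqVneq a 0.
  by rewrite (eq_bigr (fun=> 1)) ?sumr_const // => x _; rewrite mulr0 psi0.
have [z z1] := psi_nontrivial.
apply: (sum_char_eq0 (h := +%R (z / a)) _ z1) => [|x].
  by exists (+%R (- (z / a))) => x; rewrite ?addKr ?addNKr.
by rewrite mulrDl divfK // psiD.
Qed.

Lemma sum_char_neq0 (a : F) :
  \sum_(x | x != 0) psi (x * a) = (if a == 0 then #|F|%:R else 0) - 1.
Proof. by rewrite -sum_char [X in _ = X - 1](bigD1 0) //= mul0r psi0 addrAC subrr add0r. Qed.

Lemma sum_char_units : \sum_(x | x != 0) psi x = -1.
Proof.
have := sum_char_neq0 1; rewrite oner_eq0 sub0r => <-.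
by apply: eq_bigr => x _; rewrite mulr1.
Qed.

Lemma char_trace_nontrivial n (v : 'cV[F]_n) :
  v != 0 -> exists t : 'rV_n, psi (\tr (v *m t)) != 1.
Proof.
move=> /matrix0Pn [j [k]]; rewrite ord1 => vj; have [z z1] := psi_nontrivial.
(* A row supported at a coordinate where [v] is nonzero, scaled so that the trace is exactly [z]. *)
exists ((z / v j 0) *: delta_mx 0 j).
rewrite -scalemxAr mxtraceZ mxtrace_mulC trace_mx11 -rowE !mxE.
by rewrite divfK.
Qed.

Lemma sum_char_trace n (v : 'cV[F]_n) :
  \sum_(u : 'rV_n) psi (\tr (v *m u)) = if v == 0 then (#|F| ^ n)%:R else 0.
Proof.
have [->|v0] := eqVneq v 0.
  rewrite (eq_bigr (fun=> 1)) => [|u _]; last by rewrite mul0mx mxtrace0 psi0.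
  by rewrite sumr_const card_mx mul1n.
have [t t1] := char_trace_nontrivial v0.
apply: (sum_char_eq0 (h := +%R t) _ t1) => [|u].
  by exists (+%R (- t)) => x; rewrite ?addKr ?addNKr.
by rewrite mulmxDr mxtraceD psiD.
Qed.

(* For [a <> 0] this is the sum of [psi (x_0 + ... + x_m)] over the
   [(m+1)]-tuples of product [a]. *)
Fixpoint kloos_rec (m : nat) (a : F) : R :=
  if m is m'.+1 then \sum_(x | x != 0) psi x * kloos_rec m' (a / x) else psi a.

(** The determinant condition is an indicator factor, so matrices are reindexed without transporting
    a predicate. *)
Definition det_sum n (c : F) : R :=
  \sum_(g : 'M[F]_n) (\det g == c)%:R * psi (\tr g).

(** * Recursion on the size for the sums over a fixed determinant *)

Lemma big_block_mx n (f : 'M[F]_(1 + n) -> R) :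
  \sum_g f g =
  \sum_x \sum_(v : 'cV_n) \sum_(u : 'rV_n) \sum_W f (block_mx x%:M u v W).
Proof.
rewrite (reindex (fun p : (F * 'cV_n) * ('rV_n * 'M_n) =>
   block_mx p.1.1%:M p.2.1 p.1.2 p.2.2)) /=.
  rewrite pair_bigA; under [RHS]eq_bigr do rewrite pair_bigA.
  by rewrite pair_bigA.
exists (fun g => ((ulsubmx g 0 0, dlsubmx g), (ursubmx g, drsubmx g))) => /=.
  move=> [[x v] [u W]] _ /=.
  by rewrite block_mxKul block_mxKdl block_mxKur block_mxKdr !mxE eqxx.
by move=> g _; rewrite -mx11_scalar submxK.
Qed.

Lemma det_block_schur n (x : F) u v (W : 'M[F]_n) : x != 0 ->
  \det (block_mx (x%:M : 'M_1) u v W) = x * \det (W - x^-1 *: (v *m u)).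
Proof.
move=> x0; have -> : block_mx (x%:M : 'M_1) u v W =
    block_mx 1%:M 0 (x^-1 *: v) 1%:M *m
    block_mx x%:M u 0 (W - x^-1 *: (v *m u)).
  rewrite mulmx_block !mul1mx !mul0mx !addr0 mul_mx_scalar scalerA divff //.
  by rewrite scale1r -scalemxAl addrC subrK.
by rewrite det_mulmx det_lblock det_ublock !det1 !mul1r det_scalar1.
Qed.

(** Adding multiples of the first row leaves the first column alone because the corner is zero; only
    the lower right block moves. *)
Lemma det_block_row_shift n (u : 'rV[F]_n) (t v : 'cV[F]_n) (W : 'M[F]_n) :
  \det (block_mx (0%:M : 'M_1) u v (t *m u + W)) = \det (block_mx (0%:M : 'M_1) u v W).
Proof.
have -> : block_mx (0%:M : 'M_1) u v (t *m u + W) =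
    block_mx 1%:M 0 t 1%:M *m block_mx 0%:M u v W.
  by rewrite mulmx_block !mul1mx !mul0mx !addr0 mul_mx_scalar scale0r add0r.
by rewrite det_mulmx det_lblock !det1 !mul1r.
Qed.

(** For [u = 0] the determinant is [0 <> c]. Otherwise the shift of [W] by [t^T *m u] keeps the
    determinant and multiplies the character value by a constant other than [1]. *)
Lemma det_sum_corner0 n (c : F) (u : 'rV_n) (v : 'cV_n) : c != 0 ->
  \sum_W (\det (block_mx (0%:M : 'M_1) u v W) == c)%:R
    * psi (\tr (block_mx (0%:M : 'M_1) u v W)) = 0.
Proof.
move=> c0; have [->|u0] := eqVneq u 0.
  apply: big1 => W _; rewrite det_lblock det_scalar1 mul0r eq_sym.
  by rewrite (negPf c0) mul0r.
have [t] : exists t : 'rV_n, psi (\tr (u^T *m t)) != 1.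
  apply: char_trace_nontrivial; apply: contraNneq u0 => u0.
  by rewrite -(trmxK u) u0 trmx0.
rewrite -mxtrace_tr trmx_mul trmxK => t1.
apply: (sum_char_eq0 (h := +%R (t^T *m u)) _ t1) => [|W].
  by exists (+%R (- (t^T *m u))) => x; rewrite ?addKr ?addNKr.
rewrite det_block_row_shift !mxtrace_block mxtraceD !psiD.
by rewrite [RHS]mulrCA; congr (_ * _); rewrite mulrCA.
Qed.

(** With the Schur complement as new variable, the trace gains [x^-1 * \tr (v *m u)]; summing over
    [u] then kills every [v] except [0]. *)
Lemma det_sum_corner n (c x : F) : x != 0 ->
  \sum_(v : 'cV_n) \sum_(u : 'rV_n) \sum_W
    (\det (block_mx (x%:M : 'M_1) u v W) == c)%:R
    * psi (\tr (block_mx (x%:M : 'M_1) u v W))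
  = (#|F| ^ n)%:R * (psi x * det_sum n (c / x)).
Proof.
move=> x0.
pose d := psi x * det_sum n (c / x).
transitivity (\sum_(v : 'cV_n) (if x^-1 *: v == 0 then (#|F| ^ n)%:R else 0) * d).
  apply: eq_bigr => v _; rewrite -sum_char_trace mulr_suml; apply: eq_bigr => u _.
  rewrite (reindex (+%R (x^-1 *: (v *m u)))) /=; last first.
    apply: onW_bij.
    by exists (+%R (- (x^-1 *: (v *m u)))) => W; rewrite ?addKr ?addNKr.
  rewrite /d /det_sum !mulr_sumr; apply: eq_bigr => W _.
  rewrite det_block_schur // [_ + W]addrC addrK mxtrace_block mxtraceD !psiD.
  rewrite scalemxAl trace_mx11 mxE eqxx mulr1n.
  have -> : (x * \det W == c) = (\det W == c / x).
    by rewrite -[RHS](inj_eq (mulfI x0)) [x * (c / x)]mulrC divfK.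
  by ring.
rewrite (bigD1 0) //= scaler0 eqxx big1 ?addr0 // => v v0.
by rewrite scaler_eq0 invr_eq0 (negPf x0) (negPf v0) mul0r.
Qed.

Lemma det_sumS n (c : F) : c != 0 ->
  det_sum n.+1 c =
  (#|F| ^ n)%:R * \sum_(x | x != 0) psi x * det_sum n (c / x).
Proof.
move=> c0; rewrite {1}/det_sum (@big_block_mx n) (bigD1 0) //= big1 ?add0r.
  by rewrite mulr_sumr; apply: eq_bigr => x; apply: det_sum_corner.
by move=> v _; apply: big1 => u _; apply: det_sum_corner0.
Qed.

Lemma det_sumE n (c : F) : c != 0 ->
  det_sum n.+1 c = (#|F| ^ 'C(n.+1, 2))%:R * kloos_rec n c.
Proof.
elim: n c => [|n IHn] c c0.
  (* The complement is the empty matrix, of determinant [1], so only [x = c] survives. *)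
  rewrite det_sumS // expn0 !mul1r (bigD1 c) //= divff // big1 => [|x /andP[x0 xc]].
    rewrite addr0 /det_sum (big_pred1 0) => [|g]; last by rewrite /= [g]flatmx0 eqxx.
    by rewrite det_mx00 eqxx mul1r mxtrace0 psi0 mulr1.
  rewrite /det_sum big1 ?mulr0 // => g _; rewrite det_mx00 eq_sym.
  rewrite (_ : (c / x == 1) = false) ?mul0r //; apply: contraNF xc => /eqP cx.
  by rewrite -[c](divfK x0) cx mul1r.
rewrite det_sumS // binS bin1 expnD natrM mulrAC mulrC; congr (_ * _).
rewrite /= mulr_sumr; apply: eq_bigr => x x0.
by rewrite IHn ?mulf_neq0 ?invr_eq0 // mulrCA.
Qed.

(** * Fourier transform of Kloosterman sums and inversion over the trace *)

Lemma fourier_kloos_recS m (b : F) :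
  \sum_(a | a != 0) psi (- (a * b)) * kloos_rec m.+1 a =
  \sum_(x | x != 0) psi x * \sum_(a | a != 0) psi (- (a * (x * b))) * kloos_rec m a.
Proof.
under eq_bigr do rewrite /= mulr_sumr.
rewrite exchange_big /=; apply: eq_bigr => x x0; rewrite mulr_sumr.
rewrite (reindex (fun a => a * x)) /=; last first.
  by apply: onW_bij; exists (fun a => a / x) => a; rewrite ?mulfK ?divfK.
apply: eq_big => [a|a _]; first by rewrite mulf_eq0 (negPf x0) orbF.
by rewrite mulfK // mulrCA -[a * x * b]mulrA.
Qed.

(** Each level of the recursion replaces [b] by [x * b] and sums over [x]: the main term becomes the
    next Kloosterman sum at [b^-1], and the constant is multiplied by the sum of [psi] over the
    units, which is [-1]. *)
Lemma fourier_kloos_rec m (b : F) :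
  \sum_(a | a != 0) psi (- (a * b)) * kloos_rec m.+1 a =
  (if b == 0 then 0 else #|F|%:R * kloos_rec m b^-1) + (-1) ^+ m.
Proof.
elim: m b => [|m IHm] b; rewrite fourier_kloos_recS.
  transitivity (\sum_(x | x != 0) psi x * ((if x * b == 1 then #|F|%:R else 0) - 1)).
    apply: eq_bigr => x x0; congr (_ * _).
    (* The two character values combine into [psi (a * (1 - x * b))]. *)
    rewrite eq_sym -subr_eq0 -sum_char_neq0; apply: eq_bigr => a _.
    by rewrite -psiD mulrBr mulr1 addrC.
  under eq_bigr do rewrite mulrBr mulr1.
  rewrite sumrB sum_char_units opprK expr0; congr (_ + _).
  have [->|b0] := eqVneq b 0.
    by apply: big1 => x _; rewrite mulr0 eq_sym oner_eq0 mulr0.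
  rewrite (bigD1 b^-1) ?invr_eq0 //= mulVf // eqxx big1 ?addr0 1?mulrC //.
  move=> x /andP[_ xb]; rewrite (_ : (x * b == 1) = false) ?mulr0 //.
  by apply: contraNF xb => /eqP xb; rewrite -[x](mulfK b0) xb mul1r.
under eq_bigr => x x0 do rewrite IHm mulf_eq0 (negPf x0) /= mulrDr.
rewrite big_split /= -mulr_suml sum_char_units exprS; congr (_ + _).
have [_|b0] := eqVneq b 0; first by apply: big1 => x _; rewrite mulr0.
rewrite mulr_sumr; apply: eq_bigr => x x0.
by rewrite invfM mulrCA [x^-1 * _]mulrC.
Qed.

(** Scaling by [a] carries determinant [1] to [a ^+ n] and multiplies the trace by [a]. *)
Lemma sum_SL_char n (a : F) : a != 0 ->
  \sum_(g in SLset F n) psi (a * \tr g) = det_sum n (a ^+ n).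
Proof.
move=> a0; rewrite /det_sum [RHS](reindex (fun g => a *: g)) /=; last first.
  apply: onW_bij; exists (fun g => a^-1 *: g) => g.
    by rewrite scalerA mulVf ?scale1r.
  by rewrite scalerA divff ?scale1r.
rewrite big_mkcond; apply: eq_bigr => g _.
rewrite inE detZ mxtraceZ -(inj_eq (mulfI (expf_neq0 n a0))) mulr1.
by case: ifP; rewrite ?mul1r ?mul0r.
Qed.

(** Orthogonality in [a] detects [\tr g = b]; the term [a = 0] counts the whole group. *)
Lemma nbeta_char_sum n (b : F) :
  #|F|%:R * (nbeta n b)%:R =
  #|SLset F n|%:R +
  \sum_(a | a != 0) psi (- (a * b)) * det_sum n (a ^+ n).
Proof.
transitivity (\sum_(g in SLset F n) \sum_a psi (a * (\tr g - b))).
  under eq_bigr do rewrite sum_char subr_eq0.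
  rewrite -big_mkcondr /= sumr_const -[RHS]mulr_natr; congr (_ * _%:R).
  by apply: eq_card => g; rewrite !inE unfold_in inE.
rewrite exchange_big /= (bigD1 0) //=; congr (_ + _).
  under eq_bigr do rewrite mul0r psi0.
  by rewrite sumr_const.
apply: eq_bigr => a a0; rewrite -sum_SL_char // mulr_sumr.
by apply: eq_bigr => g _; rewrite -psiD mulrBr addrC.
Qed.

(** Squaring is a field automorphism in characteristic 2 and preserves [psi], so all summation
    variables can be squared at once. *)
Lemma kloos_rec_sqr m (a : F) :
  2%N \in [pchar F] -> (forall x, psi (x ^+ 2) = psi x) ->
  kloos_rec m (a ^+ 2) = kloos_rec m a.
Proof.
move=> F2 psi_sqr; elim: m a => [|m IHm] a //=.
rewrite (reindex_inj (h := fun x => x ^+ 2)) /=.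
  by apply: eq_big => [x|x _]; rewrite ?expf_eq0 // psi_sqr -expr_div_n IHm.
by move=> x y /eqP; rewrite eqf_sqr oppr_pchar2 // orbb => /eqP.
Qed.

Lemma kloos_rec_exp2 s m (a : F) :
  2%N \in [pchar F] -> (forall x, psi (x ^+ 2) = psi x) ->
  kloos_rec m (a ^+ (2 ^ s)) = kloos_rec m a.
Proof.
move=> F2 psi_sqr; elim: s => [|s IHs]; first by rewrite expr1.
by rewrite expnSr exprM kloos_rec_sqr.
Qed.

End AdditiveCharacter.

(** * The absolute trace and its character [lam] *)

Section AbsoluteTrace.

Variables (F : finFieldType) (r : nat).
Hypothesis r_gt0 : (0 < r)%N.
Hypothesis cardF : #|F| = (2 ^ r)%N.

Lemma pchar_card2 : 2%N \in [pchar F].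
Proof. exact: (card_finPcharP cardF). Qed.

Lemma sqrrD_pchar2 (x y : F) : (x + y) ^+ 2 = x ^+ 2 + y ^+ 2.
Proof. by rewrite sqrrD -mulr_natr (pcharf0 pchar_card2) mulr0 addr0. Qed.

Lemma exp2nD_pchar2 k (x y : F) : (x + y) ^+ (2 ^ k) = x ^+ (2 ^ k) + y ^+ (2 ^ k).
Proof.
by elim: k => [|k IHk]; rewrite ?expr1 // expnSr !exprM IHk sqrrD_pchar2.
Qed.

Lemma abs_trD (x y : F) : abs_tr r (x + y) = abs_tr r x + abs_tr r y.
Proof.
by rewrite /abs_tr -big_split; apply: eq_bigr => k _; apply: exp2nD_pchar2.
Qed.

(** Squaring permutes the conjugates [x ^+ (2 ^ k)] cyclically, since [x ^+ (2 ^ r) = x]. *)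
Lemma abs_tr_sqr (x : F) : abs_tr r (x ^+ 2) = abs_tr r x.
Proof.
rewrite /abs_tr -(prednK r_gt0) big_ord_recr [RHS]big_ord_recl /= addrC.
congr (_ + _); last by apply: eq_bigr => i _; rewrite -exprM -expnS.
by rewrite -exprM -expnS prednK // -cardF expf_card expr1.
Qed.

Lemma sqr_abs_tr (x : F) : abs_tr r x ^+ 2 = abs_tr r x.
Proof.
rewrite -[RHS]abs_tr_sqr /abs_tr.
rewrite (big_morph (fun y : F => y ^+ 2) sqrrD_pchar2 (expr0n _ 2)).
by apply: eq_bigr => k _; rewrite -!exprM mulnC.
Qed.

Lemma abs_trP (x : F) : (abs_tr r x == 0) || (abs_tr r x == 1).
Proof.
have /eqP := sqr_abs_tr x.
by rewrite -subr_eq0 expr2 -[X in _ - X]mulr1 -mulrBr mulf_eq0 subr_eq0.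
Qed.

Lemma lam0 : lam r (0 : F) = 1.
Proof.
rewrite /lam /abs_tr big1 ?eqxx // => k _.
by rewrite expr0n expn_eq0.
Qed.

Lemma lamD : {morph @lam F r : x y / x + y >-> x * y}.
Proof.
move=> x y; rewrite /lam abs_trD.
have [/eqP->|/eqP->] := orP (abs_trP x); have [/eqP->|/eqP->] := orP (abs_trP y);
  rewrite ?addr0 ?add0r ?eqxx ?oner_eq0 // addrr_pchar2 ?pchar_card2 // eqxx.
by rewrite mulrNN.
Qed.

Lemma lam_sqr (x : F) : lam r (x ^+ 2) = lam r x.
Proof. by rewrite /lam abs_tr_sqr. Qed.

(* The trace is a nonzero polynomial function of degree [2 ^ (r - 1) < #|F|]. *)
Lemma lam_nontrivial : exists z : F, lam r z != 1.
Proof.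
pose p : {poly F} := \sum_(k < r) 'X^(2 ^ k).
have szp : (size p <= (2 ^ r.-1).+1)%N.
  apply: (leq_trans (size_sum _ _ _)); apply/bigmax_leqP => k _.
  by rewrite size_polyXn ltnS leq_exp2l // -ltnS prednK.
have p_neq0 : p != 0.
  (* The coefficient of ['X] is [1]: for [k > 0] the exponent [2 ^ k] is even. *)
  apply: contraTneq isT => p0; have := congr1 (fun q : {poly F} => q`_1) p0.
  rewrite coef0 coef_sum -(prednK r_gt0) big_ord_recl coefXn eqxx big1 => [|i _].
    by rewrite addr0 => /eqP; rewrite oner_eq0.
  by rewrite coefXn lift0 expnS; case: eqP => // /(congr1 odd); rewrite oddM.
have [z pz|all0] := pickP (fun z : F => abs_tr r z != 0).
  by exists z; rewrite /lam (negPf pz).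
have : (size (enum F) < size p)%N.
  apply: max_poly_roots p_neq0 _ (enum_uniq _); apply/allP => z _.
  rewrite /root horner_sum (eq_bigr _ (fun i _ => hornerXn _ _)).
  by have /negbFE := all0 z.
rewrite -cardE cardF => /leq_trans /(_ szp).
by rewrite ltnS leq_exp2l // -ltnS prednK // ltnn.
Qed.

End AbsoluteTrace.

(** * Kloosterman sums over tuples *)

(** The separate clause for [m = 0] fits the general formula: the empty tuple has sum [0] and
    product [1]. This lets the recursion start at [0]. *)
Lemma KloosE (F : finFieldType) r m (a : F) :
  Kloos r m a =
  \sum_(al : {ffun 'I_m -> F} | [forall j, al j != 0])
         lam r (\sum_j al j + a * (\prod_j al j)^-1).
Proof.
case: m => [|m] //=; rewrite (big_pred1 [ffun=> 0]) => [|al /=].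
  by rewrite !big_ord0 add0r invr1 mulr1.
rewrite (_ : al == _) => [|]; last by apply/eqP/ffunP => -[].
by apply/forallP => -[].
Qed.

Lemma KloosS (F : finFieldType) r m (a : F) :
  {morph @lam F r : x y / x + y >-> x * y} ->
  Kloos r m.+1 a = \sum_(x | x != 0) lam r x * Kloos r m (a / x).
Proof.
move=> lamD; under eq_bigr do rewrite KloosE mulr_sumr.
(* The pair [(x, al)] becomes the tuple with [x] at [ord0] followed by [al]. *)
rewrite pair_big /= (reindex (fun p : F * {ffun 'I_m -> F} =>
  [ffun i : 'I_m.+1 => oapp p.2 p.1 (unlift ord0 i)])) /=; last first.
  exists (fun al => (al ord0, [ffun i => al (lift ord0 i)])) => [[x al] _|al _] /=.
    by rewrite ffunE unlift_none; congr pair; apply/ffunP => i; rewrite !ffunE liftK.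
  by apply/ffunP => i; rewrite ffunE; case: unliftP => [j|] -> /=; rewrite ?ffunE.
apply: eq_big => [[x al]|[x al] _] /=.
  apply/forallP/andP => [al0|[x0 /forallP al0] i].
    split; first by have := al0 ord0; rewrite ffunE unlift_none.
    by apply/forallP => j; have := al0 (lift ord0 j); rewrite ffunE liftK.
  by rewrite ffunE; case: unliftP => [j|] _ /=.
rewrite !big_ord_recl !ffunE unlift_none /= -lamD -addrA invfM mulrA.
by congr (lam r (_ + (_ + _ * _^-1))); apply: eq_bigr => j _; rewrite ffunE liftK.
Qed.

(** * The order of the special linear group *)

Section CardSL.

Variable F : finFieldType.

(** Left multiplication by the diagonal matrix with entries [c, 1, ..., 1] is a bijection from
    [SLset] onto the fibre. *)
Lemma card_det_fiber n (c : F) : c != 0 ->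
  #|[set g : 'M[F]_n.+1 | \det g == c]| = #|SLset F n.+1|.
Proof.
move=> c0; pose d : 'M[F]_n.+1 := diag_mx (\row_j (if j == 0 then c else 1)).
have dd : \det d = c.
  rewrite det_diag big_ord_recl mxE eqxx big1 ?mulr1 // => i _.
  by rewrite mxE.
have du : d \in unitmx by rewrite unitmxE dd unitfE.
rewrite -[RHS](card_imset _ (can_inj (mulKmx du))); apply: eq_card => g.
rewrite inE; apply/eqP/imsetP => [gc|[h]].
  by exists (invmx d *m g); rewrite ?mulKVmx // inE det_mulmx det_inv dd gc mulVf.
by rewrite inE => /eqP h1 ->; rewrite det_mulmx dd h1 mulr1.
Qed.

Lemma card_GL_SL n : #|'GL_n.+1[F]%g| = (#|F|.-1 * #|SLset F n.+1|)%N.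
Proof.
rewrite cardsT card_sub -[LHS]sum1_card.
rewrite (partition_big (fun g : 'M[F]_n.+1 => \det g) (fun c => c != 0)) /=.
  rewrite (eq_bigr (fun=> #|SLset F n.+1|)) => [|c c0].
    by rewrite sum_nat_const; congr (_ * _)%N; rewrite -(cardC1 (0 : F)).
  rewrite -(card_det_fiber _ c0) -sum1_card; apply: eq_bigl => g.
  rewrite inE andbC; case: eqP => //= gc; rewrite -topredE /=.
  by rewrite [_ \in _]unitmxE gc unitfE.
by move=> g; rewrite [_ \in _]unitmxE unitfE.
Qed.

Lemma card_SLset n : (0 < n)%N ->
  #|SLset F n| = (#|F| ^ 'C(n, 2) * \prod_(2 <= j < n.+1) (#|F| ^ j - 1))%N.
Proof.
case: n => // n _; have := card_GL F (ltn0Sn n).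
(* The factor [j = 1] of the order of [GL] is [#|F| - 1], the number of determinants; it cancels. *)
rewrite card_GL_SL big_ltn // expn1 -subn1 mulnCA => /eqP.
by rewrite eqn_pmul2l ?subn_gt0 ?finNzRing_gt1 // => /eqP.
Qed.

End CardSL.

(** * Counting subsets by their intersections with fibres *)

Section SubsetProfiles.

Variables (I J : finType) (f : I -> J).

Local Notation fiber b := (f @^-1: [set b]).

(** A subset amounts to an independent choice of a subset of each fibre. *)
Lemma card_subsets_profile (nu : J -> nat) :
  #|[set A : {set I} | [forall b, #|A :&: fiber b| == nu b]]| =
  (\prod_b 'C(#|fiber b|, nu b))%N.
Proof.
transitivity #|[set phi : {ffun J -> {set I}} |
    [forall b, (phi b \subset fiber b) && (#|phi b| == nu b)]]|; last first.
  under eq_bigr do rewrite -cards_draws -sum1_card big_mkcond.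
  (* Expanding the product of sums yields one sum over all families [phi]. *)
  rewrite bigA_distr_bigA -sum1_card big_mkcond /=; apply: eq_bigr => phi _.
  rewrite inE; case: forallP => [phiP|phiP].
    by rewrite big1 // => b _; rewrite inE phiP.
  have [b phib] : exists b, ~~ ((phi b \subset fiber b) && (#|phi b| == nu b)).
    by apply/existsP; rewrite -negb_forall; apply/forallP.
  by rewrite (bigD1 b) //= inE (negPf phib).
pose split (A : {set I}) := [ffun b => A :&: fiber b].
have in_split A i : (i \in split A (f i)) = (i \in A).
  by rewrite ffunE !inE eqxx andbT.
have split_inj : injective split.
  by move=> A B AB; apply/setP => i; rewrite -in_split AB in_split.
rewrite -(card_imset _ split_inj); apply: eq_card => phi.
rewrite inE; apply/imsetP/forallP => [[A]|phiP].
  by rewrite inE => /forallP AP -> b; rewrite ffunE subsetIr AP.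
(* The inverse of [split] tests [i] only in the component of its own fibre. *)
have phiE : phi = split [set i | i \in phi (f i)].
  apply/ffunP => b; rewrite ffunE; apply/setP => i; rewrite !inE.
  have /andP[/subsetP sub _] := phiP b.
  apply/idP/andP => [ib|[ib /eqP<-] //].
  by have := sub i ib; rewrite !inE => /eqP fi; rewrite fi ib eqxx.
exists [set i | i \in phi (f i)] => //; rewrite inE; apply/forallP => b.
by have /andP[_] := phiP b; rewrite {1}phiE ffunE.
Qed.

Lemma sum_fiber_card (A : {set I}) : (\sum_b #|A :&: fiber b|)%N = #|A|.
Proof.
rewrite -[RHS]sum1_card (partition_big f predT) //=; apply: eq_bigr => b _.
by rewrite -sum1_card; apply: eq_bigl => i; rewrite !inE.
Qed.

End SubsetProfiles.

Lemma sum_fiber_mulrn (I : finType) (V : finZmodType) (f : I -> V) (A : {set I}) :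
  \sum_(b : V) b *+ #|A :&: f @^-1: [set b]| = \sum_(i in A) f i.
Proof.
rewrite [RHS](partition_big f predT) //=; apply: eq_bigr => b _.
rewrite -sumr_const; apply: eq_big => [i|i]; first by rewrite !inE.
by rewrite !inE => /andP[_ /eqP].
Qed.

(** Both the size of [A] and the sum of [f] over it depend only on the profile of [A], so the
    subsets can be grouped by profile. *)
Lemma card_subsets_sum_eq0 (I : finType) (V : finZmodType) (f : I -> V) i :
  #|[set A : {set I} | (\sum_(j in A) f j == 0) && (#|A| == i)]| =
  (\sum_(nu : {ffun V -> 'I_i.+1} |
       ((\sum_b (nu b : nat))%N == i) && ((\sum_b b *+ nu b)%R == 0%R))
     \prod_b 'C(#|f @^-1: [set b]|, nu b))%N.
Proof.
(* [inord] loses nothing when [#|A| = i], as each intersection then has at most [i] elements. *)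
pose prof (A : {set I}) := [ffun b => inord #|A :&: f @^-1: [set b]|] : {ffun V -> 'I_i.+1}.
have profE (A : {set I}) b : #|A| = i -> prof A b = #|A :&: f @^-1: [set b]| :> nat.
  by move=> Ai; rewrite ffunE inordK // ltnS -Ai subset_leq_card ?subsetIl.
rewrite -sum1_card (partition_big prof (fun nu =>
  ((\sum_b (nu b : nat))%N == i) && (\sum_b b *+ nu b == 0))) /=; last first.
  move=> A; rewrite inE => /andP[/eqP A0 /eqP Ai].
  under eq_bigr do rewrite profE //.
  rewrite sum_fiber_card Ai eqxx.
  under eq_bigr do rewrite profE //.
  by rewrite sum_fiber_mulrn A0 /=.
apply: eq_bigr => nu /andP[/eqP nu_i /eqP nu0].
rewrite -card_subsets_profile -sum1_card; apply: eq_bigl => A; rewrite !inE.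
apply/andP/forallP => [[/andP[_ /eqP Ai] /eqP <-] b|AP].
  by rewrite profE.
have nuE b : nu b = #|A :&: f @^-1: [set b]| :> nat by rewrite (eqP (AP b)).
have Ai : #|A| = i.
  by rewrite -(sum_fiber_card f) -nu_i; apply: eq_bigr => b _; rewrite nuE.
rewrite Ai -sum_fiber_mulrn; split.
  by under eq_bigr do rewrite -nuE; rewrite nu0 !eqxx.
by apply/eqP/ffunP => b; apply: val_inj; rewrite /= profE.
Qed.

(** * Codewords, trace fibres and the final formulas *)

(** A binary word is determined by its support, and its dot product with the traces is the sum over
    that support. *)
Lemma weight_countE (F : finFieldType) n N (g : 'I_N -> 'M[F]_n) i :
  weight_count g i =
  #|[set A : {set 'I_N} | (\sum_(j in A) \tr (g j) == 0) && (#|A| == i)]|.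
Proof.
have h_inj : injective (fun A : {set 'I_N} => [ffun j => j \in A]).
  by move=> A B /ffunP AB; apply/setP => j; have := AB j; rewrite !ffunE.
rewrite -[RHS](card_imset _ h_inj); apply: eq_card => u.
have uE : u = [ffun j => j \in [set k | u k]] by apply/ffunP => j; rewrite !ffunE inE.
have sumE : \sum_(j < N) (u j)%:R * \tr (g j) = \sum_(j in [set k | u k]) \tr (g j).
  rewrite [RHS]big_mkcond; apply: eq_bigr => j _; rewrite inE.
  by case: (u j); rewrite ?mul1r ?mul0r.
have cardE : #|[pred j | u j]| = #|[set k | u k]| by apply: eq_card => j; rewrite !inE.
rewrite inE sumE cardE; apply/idP/imsetP => [uP|[A]].
  by exists [set k | u k]; rewrite ?inE.
rewrite inE => AP uA; suff -> : [set k | u k] = A by [].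
by apply: h_inj; rewrite -uE.
Qed.

Lemma card_trace_fiber (F : finFieldType) n (g : 'I_#|@SLset F n| -> 'M[F]_n)
    (b : F) : injective g -> (forall j, g j \in SLset F n) ->
  #|(fun j => \tr (g j)) @^-1: [set b]| = nbeta n b.
Proof.
move=> g_inj gSL.
(* An injection into a set of the same cardinality is onto. *)
have gE : g @: setT = SLset F n.
  apply/eqP; rewrite eqEcard card_imset // cardsT card_ord leqnn andbT.
  by apply/subsetP => _ /imsetP[j _ ->].
rewrite -(card_imset _ g_inj); apply: eq_card => x; rewrite !inE.
rewrite (_ : (\det x == 1) = (x \in g @: setT)); last by rewrite gE inE.
apply/imsetP/andP => [[j]|[/imsetP[j _ ->] xb]].
  by rewrite !inE => jb ->; rewrite imset_f ?inE.
by exists j; rewrite ?inE.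
Qed.

Lemma Kloos_kloos_rec (F : finFieldType) r m (a : F) :
  {morph @lam F r : x y / x + y >-> x * y} ->
  Kloos r m a = kloos_rec (lam r) m a.
Proof.
move=> lamD; elim: m a => [|m IHm] a //.
by rewrite KloosS //=; apply: eq_bigr => x _; rewrite IHm.
Qed.

(** Multiplying through by [2 ^ r] avoids a division in [int]; writing the size as [m.+2] turns
    [n - 2] into [m]. *)
Lemma card_nbeta (F : finFieldType) (r s m : nat) (b : F) :
    (0 < r)%N -> #|F| = (2 ^ r)%N -> (2 ^ s = m.+2)%N ->
  (2 ^ r)%N%:Z * (nbeta m.+2 b)%:Z =
  ((2 ^ r) ^ 'C(m.+2, 2))%N%:Z *
    (\prod_(2 <= j < m.+3) (((2 ^ r) ^ j)%N%:Z - 1) + 1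
     + (2 ^ r)%N%:Z * theta r m.+2 b).
Proof.
move=> r_gt0 cardF sE; have lamD := lamD r_gt0 cardF.
(* The size is a power of 2 and at least 2, hence even, so the constant [(-1) ^+ m] is [+1]. *)
have odd_m : ~~ odd m.
  have: odd m.+2 = odd m by rewrite /= negbK.
  by move=> <-; rewrite -sE oddX orbF; case: s sE.
have cardSL : #|SLset F m.+2|%:Z =
    ((2 ^ r) ^ 'C(m.+2, 2))%N%:Z * \prod_(2 <= j < m.+3) (((2 ^ r) ^ j)%N%:Z - 1).
  rewrite card_SLset // cardF PoszM; congr (_ * _).
  rewrite (big_morph Posz PoszM (erefl 1%Z)); apply: eq_bigr => j _.
  by rewrite subzn // !expn_gt0.
have lam1 := lam_nontrivial r_gt0 cardF.
have := nbeta_char_sum (lam0 F r) lamD lam1 m.+2 b.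
rewrite (eq_bigr (fun a => ((2 ^ r) ^ 'C(m.+2, 2))%:R *
    (lam r (- (a * b)) * kloos_rec (lam r) m.+1 a))) => [|a a0]; last first.
  rewrite (det_sumE (lam0 F r) lamD lam1) ?expf_neq0 // cardF mulrCA -sE.
  by rewrite (kloos_rec_exp2 _ _ _ (pchar_card2 cardF) (lam_sqr r_gt0 cardF)).
rewrite -mulr_sumr (fourier_kloos_rec (lam0 F r) lamD lam1).
rewrite cardF !natz => ->; rewrite cardSL -mulrDr -addrA; congr (_ * (_ + _)).
rewrite -signr_odd (negPf odd_m) expr0 addrC; congr (_ + _).
rewrite /theta subn2 /=; case: eqP => _; first by rewrite mulr0.
by rewrite Kloos_kloos_rec.
Qed.

Theorem theorem16 (F : finFieldType) (r s : nat) (hr : (0 < r)%N) (hs : (0 < s)%N)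
  (hF : #|F| = (2 ^ r)%N)
  (g : 'I_#|@SLset F (2 ^ s)| -> 'M[F]_(2 ^ s))
  (hinj : injective g) (hSL : forall j, g j \in @SLset F (2 ^ s)) :
  (forall b : F,
     (@nbeta F (2 ^ s) b)%:Z =
       ((2 ^ r) ^ ('C(2 ^ s, 2) - 1))%N%:Z *
       (\prod_(2 <= j < (2 ^ s).+1) (((2 ^ r) ^ j)%N%:Z - 1) + 1
          + (2 ^ r)%N%:Z * theta r (2 ^ s) b)) /\
  (forall i : nat, (i <= #|@SLset F (2 ^ s)|)%N ->
     weight_count g i =
       (\sum_(nu : {ffun F -> 'I_i.+1} |
               ((\sum_(b : F) (nu b : nat))%N == i) && ((\sum_(b : F) b *+ nu b)%R == 0%R))
          \prod_(b : F) 'C(@nbeta F (2 ^ s) b, nu b))%N).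
Proof.
split=> [b|i _].
  have [m sE] : exists m, (2 ^ s)%N = m.+2.
    exists (2 ^ s - 2)%N; rewrite -[RHS]addn2 subnK //.
    by rewrite -{1}(expn1 2) leq_exp2l.
  have q0 : (2 ^ r)%N%:Z != 0 by rewrite eqz_nat expn_eq0.
  (* The cancelled factor raises the exponent ['C(n, 2) - 1] by one; the truncated subtraction is
     exact as ['C(n, 2) > 0]. *)
  rewrite sE; apply: (mulfI q0); rewrite (card_nbeta _ hr hF sE) [RHS]mulrA.
  by rewrite -PoszM -expnS subn1 prednK // bin_gt0.
rewrite weight_countE card_subsets_sum_eq0; apply: eq_bigr => nu _.
by apply: eq_bigr => b _; rewrite card_trace_fiber.
Qed.
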